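(* For any symmetric probability measure $\mu$ on $\mathbb{R}$, $$W_2(\mu,\mathrm{b})^2\le 2\,\Gamma(\mu|\mathrm{b}).$$
   Context: $\mathrm{b}=\frac12\delta_{-1}+\frac12\delta_{1}$ is the Rademacher distribution. $W_2(\mu,\nu)=\inf_\pi\left(\iint|x-y|^2\,d\pi(x,y)\right)^{1/2}$, the infimum being over all couplings of $(\mu,\nu)$. The Boolean entropy of $\mu$ relative to $\mathrm{b}$ is $$\Gamma(\mu|\mathrm{b})=\frac12\int x^2\,d\mu(x)-\int\log|x|\,d\mu(x)-\frac12\in[0,+\infty],$$ understood as the integral $\int\left(\frac12x^2-\log|x|-\frac12\right)d\mu(x)$ of a nonnegative function (equal to $+\infty$ at $x=0$). *)

(* Defs.v *)
From HB Require Import structures.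
From mathcomp Require Import all_boot all_order all_algebra.
From mathcomp Require Import all_classical all_reals all_analysis.

Set Implicit Arguments.
Unset Strict Implicit.
Unset Printing Implicit Defensive.

Import Order.TTheory GRing.Theory Num.Theory.

Local Open Scope classical_set_scope.
Local Open Scope ring_scope.

Section rademacher.
Context (R : realType).
Local Open Scope ereal_scope.

Definition rademacher : set R -> \bar R :=
  measure_add (mscale ((2^-1)%:nng : {nonneg R})%R \d_(-1 : R)%R)
              (mscale ((2^-1)%:nng : {nonneg R})%R \d_(1 : R)%R).

HB.instance Definition _ := Measure.copy rademacher (measure_add _ _).

Lemma rademacherE (A : set R) :
  rademacher A = (2^-1)%:E * \d_(-1 : R)%R A + (2^-1)%:E * \d_(1 : R)%R A.
Proof. exact: measure_addE. Qed.

Let rademacher_setT : rademacher setT = 1.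
Proof.
by rewrite rademacherE !diracT !mule1 -EFinD [in RHS](splitr 1%R) mul1r.
Qed.

HB.instance Definition _ :=
  @Measure_isProbability.Build _ _ R rademacher rademacher_setT.

End rademacher.
Arguments rademacher R : clear implicits.

(* Measures are compared on measurable sets only: their values elsewhere are
   unconstrained in MathComp-Analysis. *)
Definition symmetric_measure (R : realType) (mu : probability R R) : Prop :=
  forall A : set R, measurable A -> pushforward mu (-%R : R -> R) A = mu A.

Definition couplings (R : realType) (mu nu : probability R R) :
    set (probability (R * R)%type R) :=
  [set pi | forall A : set R, measurable A ->
              pushforward pi fst A = mu A /\ pushforward pi snd A = nu A].

Definition W2 (R : realType) (mu nu : probability R R) : \bar R :=
  ereal_inf
    [set ((\int[pi]_z (`|z.1 - z.2| ^+ 2)%:E) `^ 2^-1)%E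
      | pi in couplings mu nu].

(* [lne 0 = -oo], so the integrand is [+oo] at [x = 0]. *)
Definition boolean_entropy (R : realType) (mu : probability R R) : \bar R :=
  (\int[mu]_x ((2^-1 * x ^+ 2)%:E - lne `|x|%:E - (2^-1)%:E))%E.

(* Main.v *)
(** Couple [mu] with the Rademacher law through the sign of [x]. When [mu] has
    no atom at 0, symmetry makes the sign a Rademacher variable, and the
    transport cost is the integral of [(|x| - 1)^2], which is at most
    [x^2 - 2 ln |x| - 1] pointwise since [ln t <= t - 1]. When [mu] has an atom
    at 0, the entropy is infinite. *)
From HB Require Import structures.
Require Import Defs.
From mathcomp Require Import all_boot all_order all_algebra.
From mathcomp Require Import all_classical all_reals all_analysis.
From mathcomp Require Import measurable_realfun lra.

Set Implicit Arguments.
Unset Strict Implicit.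
Unset Printing Implicit Defensive.

Import Order.TTheory GRing.Theory Num.Theory.

Local Open Scope classical_set_scope.
Local Open Scope ring_scope.

Section entropy_density.
Context (R : realType).
Implicit Types x : R.

Definition entropy_density x : \bar R :=
  ((2^-1 * x ^+ 2)%:E - lne `|x|%:E - (2^-1)%:E)%E.

Lemma entropy_density0 : entropy_density 0 = +oo%E.
Proof. by rewrite /entropy_density normr0 le0_lneNy. Qed.

Lemma entropy_density_fin x : x != 0 ->
  entropy_density x = (2^-1 * x ^+ 2 - ln `|x| - 2^-1)%:E.
Proof. by move=> x0; rewrite /entropy_density lne_EFin ?normr_gt0. Qed.

Lemma sqr_norm_sub1_le x :
  (((`|x| - 1) ^+ 2)%:E <= 2%:E * entropy_density x)%E.
Proof.
have [->|x0] := eqVneq x 0.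
  by rewrite entropy_density0 gt0_muley ?leey// lte_fin.
rewrite entropy_density_fin// -EFinM lee_fin.
have : ln `|x| <= `|x| - 1.
  (* Writing [|x|] as [1 + (|x| - 1)] gives the form [ln (1 + y) <= y], valid since [y > -1]. *)
  rewrite -{1}(subrKC 1 `|x|) le_ln1Dx//.
  by move: x0; rewrite -normr_gt0; lra.
(* Once [x ^+ 2] is identified with [|x| ^+ 2], the right side minus the left is
   [2 * (|x| - 1 - ln |x|)]. *)
have := real_normK (num_real x).
nra.
Qed.

Lemma entropy_density_ge0 x : (0 <= entropy_density x)%E.
Proof.
rewrite -(@pmule_rge0 _ 2%:E) ?lte_fin//.
by rewrite (le_trans _ (sqr_norm_sub1_le x))// lee_fin sqr_ge0.
Qed.

Lemma measurable_entropy_density : measurable_fun setT entropy_density.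
Proof.
(* Isolating the infinite value at 0 leaves a real-valued branch. *)
have -> : entropy_density = fun x => if x == 0 then +oo%E else
    (2^-1 * x ^+ 2 - ln `|x| - 2^-1)%:E.
  apply/funext => x; case: eqVneq => [->|]; first exact: entropy_density0.
  exact: entropy_density_fin.
apply: measurable_fun_ifT => //; first exact: measurable_fun_eqr.
apply/measurable_EFinP; apply: measurable_funB => //.
apply: measurable_funB; first exact: measurable_funM.
exact: measurableT_comp.
Qed.

End entropy_density.

Section sign_coupling.
Context (R : realType) (mu : probability R R).

(** The value at 0 is 1, so the sign always lies in the support of the Rademacher law. *)
Definition sign_pm (x : R) : R := if x < 0 then -1 else 1.

Lemma dist_sign_pm (x : R) : `|x - sign_pm x| ^+ 2 = (`|x| - 1) ^+ 2.
Proof.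
rewrite real_normK ?num_real// /sign_pm; case: ltP => x0.
  by rewrite ltr0_norm//; lra.
by rewrite ger0_norm.
Qed.

Definition sign_pair (x : R) : R * R := (x, sign_pm x).

Lemma measurable_sign_pair : measurable_fun setT sign_pair.
Proof.
apply: measurable_fun_pair => //.
by apply: measurable_fun_ifT => //; exact: measurable_fun_ltr.
Qed.

HB.instance Definition _ :=
  isMeasurableFun.Build _ _ _ _ sign_pair measurable_sign_pair.

Definition sign_coupling : probability (R * R)%type R :=
  distribution mu sign_pair.

Lemma transport_cost_sign_coupling :
  (\int[sign_coupling]_z (`|z.1 - z.2| ^+ 2)%:E =
   \int[mu]_x ((`|x| - 1) ^+ 2)%:E)%E.
Proof.
rewrite ge0_integral_pushforward//=.
  by apply: eq_integral => x _ /=; rewrite dist_sign_pm.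
apply/measurable_EFinP; apply: measurable_funX; apply: measurableT_comp => //.
exact: measurable_funB.
Qed.

(** Reflection exchanges the two open half-lines and adding 0 costs no mass, so both sides weigh the
    same and sum to 1. *)
Lemma symmetric_half : symmetric_measure mu -> mu [set 0] = 0%E ->
  mu `]-oo, 0[%classic = (2^-1)%:E /\ mu `[0, +oo[%classic = (2^-1)%:E.
Proof.
move=> mu_sym mu0.
have ge0E : mu `[0, +oo[%classic = mu `]-oo, 0[%classic.
  rewrite -(@setU1itv _ _ _ _ false)// measureU//=; last first.
    by rewrite -subset0 => x [->] /=; rewrite in_itv/= ltxx.
  rewrite [X in (X + _)%E]mu0 add0e -mu_sym//; congr (mu _).
  by apply/seteqP; split => x /=; rewrite !in_itv/= andbT oppr_gt0.
have : (mu `]-oo, 0%R[%classic + mu `[0%R, +oo[%classic = 1)%E.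
  rewrite -measureU//; last first.
    rewrite -subset0 => x [] /=; rewrite !in_itv/= andbT => x0.
    by rewrite leNgt x0.
  rewrite -(@probability_setT _ _ _ mu); congr (mu _).
  rewrite -subTset => x _ /=; rewrite !in_itv/= andbT.
  by case: ltP; [left|right].
rewrite ge0E.
(* Finiteness turns the equation into [r + r = 1] over the reals. *)
have : mu `]-oo, 0[%classic \is a fin_num by exact: fin_num_measure.
case: (mu _) => // r _; rewrite -EFinD => -[] rr.
by have -> : r = 2^-1 by lra.
Qed.

Lemma sign_coupling_couplings : symmetric_measure mu -> mu [set 0] = 0%E ->
  couplings mu (rademacher R) sign_coupling.
Proof.
move=> mu_sym mu0 A mA; split => //.
have [mun mup] := symmetric_half mu_sym mu0.
have constT (P : Prop) : P -> [set _ : R | P] = setT.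
  by move=> p; apply/seteqP; split.
have const0 (P : Prop) : ~ P -> [set _ : R | P] = set0.
  by move=> np; apply/seteqP; split.
have mI (P : Prop) (B : set R) : measurable B -> measurable (B `&` [set _ | P]).
  move=> mB; have [p|np] := pselect P.
    by rewrite constT// setIT.
  by rewrite const0// setI0.
(* Each set [[set _ | P]] is everything or empty, so one formula covers all cases of which of -1 and
   1 lie in [A]; these indicators become the two Dirac masses. *)
have preE : sign_pm @^-1` A =
    (`]-oo, 0[%classic `&` [set _ | A (-1)]) `|`
    (`[0, +oo[%classic `&` [set _ | A 1]).
  apply/seteqP; split => x /=; rewrite /sign_pm !in_itv/= andbT.
    by case: ltP; [left|right].
  by case: ltP => x0 [] [].
transitivity (mu (sign_pm @^-1` A)) => //.
rewrite preE measureU; [|exact: mI|exact: mI|]; last first.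
  rewrite -subset0 => x [] /=; rewrite !in_itv/= andbT => -[x0 _] [+ _].
  by rewrite leNgt x0.
have muI (P : Prop) (B : set R) : mu B = (2^-1)%:E ->
    mu (B `&` [set _ | P]) = ((2^-1)%:E * (`[< P >]%:R)%:E)%E.
  move=> muB; have [p|np] := pselect P.
    by rewrite constT// setIT asboolT// mule1.
  by rewrite const0// setI0 measure0 asboolF// mule0.
rewrite [RHS]rademacherE !diracE.
by congr (_ + _)%E; [exact: (muI _ _ mun)|exact: (muI _ _ mup)].
Qed.

End sign_coupling.

(** The density is nonnegative and equals [+oo] at 0, so the integral over the atom alone already
    diverges. *)
Lemma boolean_entropy_atom0 (R : realType) (mu : probability R R) :
  mu [set 0] != 0%E -> boolean_entropy mu = +oo%E.
Proof.
move=> mu0; apply/eqP; rewrite -leye_eq.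
apply: (@le_trans _ _ (\int[mu]_(x in [set 0%R]) entropy_density x)%E).
  rewrite (@eq_integral _ _ _ _ _ (cst +oo%E)) => [|x]; last first.
    by rewrite inE => ->; exact: entropy_density0.
  by rewrite integral_cst// gt0_mulye// lt0e mu0/=.
apply: ge0_subset_integral => //; first exact: measurable_entropy_density.
by move=> x _; exact: entropy_density_ge0.
Qed.

Lemma sqr_W2_le_cost (R : realType) (mu nu : probability R R)
    (pi : probability (R * R)%type R) : couplings mu nu pi ->
  (W2 mu nu ^+ 2 <= \int[pi]_z (`|z.1 - z.2| ^+ 2)%:E)%E.
Proof.
move=> cpi; set c := integral _ _ _.
have c0 : (0 <= c)%E by apply: integral_ge0 => z _; rewrite lee_fin exprn_ge0.
have cE : ((c `^ 2^-1) ^+ 2 = c)%E.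
  by rewrite poweR12_sqrt// sqr_sqrte.
(* Squares of nonnegative extended reals compare like their bases, which reduces the claim to the
   infimum being at most the value at [pi]. *)
rewrite -[leRHS]cE lee_sqr ?poweR_ge0//.
- by apply: ge_ereal_inf; exists (c `^ 2^-1)%E => //; exists pi.
- by apply/ereal_infP => _ [? _ <-]; exact: poweR_ge0.
Qed.

Theorem theorem1p13 (R : realType) (mu : probability R R)
    (mu_sym : symmetric_measure mu) :
  (W2 mu (rademacher R) ^+ 2 <= 2%:E * boolean_entropy mu)%E.
Proof.
have [mu0|mu0] := eqVneq (mu [set 0]) 0%E; last first.
  by rewrite boolean_entropy_atom0// gt0_muley ?leey// lte_fin.
apply: (le_trans (sqr_W2_le_cost (sign_coupling_couplings mu_sym mu0))).
(* The factor 2 moves under the integral, so that [sqr_norm_sub1_le] can be integrated. *)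
rewrite transport_cost_sign_coupling -ge0_integralZl//.
- apply: ge0_le_integral => //.
  + by move=> x _; rewrite lee_fin sqr_ge0.
  + apply/measurable_EFinP; apply: measurable_funX.
    exact: measurable_funB.
  + by apply: measurable_funeM; exact: measurable_entropy_density.
  + by move=> x _; exact: sqr_norm_sub1_le.
- exact: measurable_entropy_density.
- by move=> x _; exact: entropy_density_ge0.
Qed.
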